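(* Let $r_\pm>0$ and $\Theta_\pm\in S^{n-1}$ with $\Theta_+\ne\pm\Theta_-$, and write $K_\pm=K(\Theta_\pm)$. Let $K(\Theta_-)>0>K(\Theta_+)$. Suppose $\Theta_\sigma\in S^{n-1}$ is the direction of a delta-shock with states $r_\pm\Theta_\pm$, i.e. $$\varrho\,\Theta_\sigma=\alpha_+\Theta_++\alpha_-\Theta_-,\qquad \varrho=|\alpha_+\Theta_++\alpha_-\Theta_-|,\qquad K(\Theta_\sigma)=0.$$ Then $\Theta_\sigma$ is given by $$\Theta_\sigma=\frac{K_-\Theta_+-K_+\Theta_-}{|K_-\Theta_+-K_+\Theta_-|},$$ provided $\Theta_+,\Theta_-$ satisfy the relationship $$K\left(\frac{K_-\Theta_+-K_+\Theta_-}{|K_-\Theta_+-K_+\Theta_-|}\right)=0 .$$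
   Context: Setting: the system $\mathbf u_t+(\phi(z)\mathbf u)_x=\mathbf 0$, $\mathbf u=r\Theta\in\mathbb R^n$, $n\ge2$, $r=|\mathbf u|$, $z=rK(\Theta)$, with Riemann states $\mathbf u_-=r_-\Theta_-$ (left) and $\mathbf u_+=r_+\Theta_+$ (right). $K:S^{n-1}\to\mathbb R$ is smooth and odd, $K(-\Theta)=-K(\Theta)$, with $K=0$ implying that the gradient of $K$ on the sphere is nonzero; $\phi:\mathbb R\to\mathbb R$ is smooth with $\phi(0)=0$, $\phi_z>0$ and $(\phi(z)z)_{zz}>0$. Put $z_\pm=r_\pm K_\pm$, $\phi_\pm=\phi(z_\pm)$, $s=\dfrac{\phi(z_-)z_--\phi(z_+)z_+}{z_--z_+}$ and $\alpha_\pm=\pm(s-\phi_\pm)r_\pm$. *)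

(* Defs.v *)
From HB Require Import structures.
From mathcomp Require Import all_boot all_order all_algebra.
From mathcomp Require Import all_classical all_reals all_analysis.

Set Implicit Arguments.
Unset Strict Implicit.
Unset Printing Implicit Defensive.

Import Order.TTheory GRing.Theory Num.Theory.
Import numFieldNormedType.Exports.

Local Open Scope classical_set_scope.
Local Open Scope ring_scope.

(* The library norm on 'rV[R]_n is the sup norm, so the Euclidean one is
   introduced here.  The topology is the same. *)
Definition l2norm (R : realType) (n : nat) (x : 'rV[R]_n) : R :=
  Num.sqrt (\sum_(i < n) x 0 i ^+ 2).

Definition sphere (R : realType) (n : nat) : set 'rV[R]_n :=
  [set x | l2norm x = 1].

(* x / |x|, with value 0 at x = 0 *)
Definition direction (R : realType) (n : nat) (x : 'rV[R]_n) : 'rV[R]_n :=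
  (l2norm x)^-1 *: x.

Definition partial (R : realType) (n : nat) (i : 'I_n) (f : 'rV[R]_n -> R) :
    'rV[R]_n -> R :=
  fun x => 'D_(delta_mx 0 i) f x.

Definition iter_partial (R : realType) (n : nat) (s : seq 'I_n)
    (f : 'rV[R]_n -> R) : 'rV[R]_n -> R :=
  foldr (@partial R n) f s.

(* C^infinity on U, meant for U open: the partial derivatives of every order
   exist and are continuous at each point of U. *)
Definition smooth_on (R : realType) (n : nat) (U : set 'rV[R]_n)
    (f : 'rV[R]_n -> R) : Prop :=
  forall (s : seq 'I_n) (x : 'rV[R]_n), U x ->
    {for x, continuous (iter_partial s f)} /\
    (forall i : 'I_n, derivable (iter_partial s f) x (delta_mx 0 i)).

(* A function on S^{n-1} is represented by K : 'rV_n -> R, of which only the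
   values on the sphere matter.  Its extension to R^n \ {0} that is constant
   along rays depends only on those values. *)
Definition radial_ext (R : realType) (n : nat) (K : 'rV[R]_n -> R) :
    'rV[R]_n -> R :=
  fun x => K (direction x).

(* x |-> x / |x| is a smooth retraction of R^n \ {0} onto the sphere, so K is
   smooth on the sphere exactly when its radial extension is smooth. *)
Definition smooth_on_sphere (R : realType) (n : nat) (K : 'rV[R]_n -> R) :
    Prop :=
  smooth_on [set x : 'rV[R]_n | x <> 0] (radial_ext K).

(* At a point T of the sphere the ambient gradient of the radial extension has
   no radial component: it is the tangential gradient of K at T. *)
Definition sphere_gradient (R : realType) (n : nat) (K : 'rV[R]_n -> R)
    (T : 'rV[R]_n) : 'rV[R]_n :=
  \row_(i < n) partial i (radial_ext K) T.

Definition admissible_K (R : realType) (n : nat) (K : 'rV[R]_n -> R) : Prop :=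
  [/\ smooth_on_sphere K,
      (forall T, sphere T -> K (- T) = - K T) &
      (forall T, sphere T -> K T = 0 -> sphere_gradient K T <> 0)].

Definition admissible_phi (R : realType) (phi : R -> R) : Prop :=
  [/\ (forall (k : nat) (z : R), derivable (derive1n k phi) z 1),
      phi 0 = 0,
      (forall z : R, 0 < derive1 phi z) &
      (forall z : R, 0 < derive1n 2 (fun y : R => phi y * y) z)].

Definition shock_speed (R : realType) (phi : R -> R) (zm zp : R) : R :=
  (phi zm * zm - phi zp * zp) / (zm - zp).

Definition alpha_minus (R : realType) (n : nat) (phi : R -> R)
    (K : 'rV[R]_n -> R) (rm rp : R) (Tm Tp : 'rV[R]_n) : R :=
  let zm := rm * K Tm in
  let zp := rp * K Tp in
  - (shock_speed phi zm zp - phi zm) * rm.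

Definition alpha_plus (R : realType) (n : nat) (phi : R -> R)
    (K : 'rV[R]_n -> R) (rm rp : R) (Tm Tp : 'rV[R]_n) : R :=
  let zm := rm * K Tm in
  let zp := rp * K Tp in
  (shock_speed phi zm zp - phi zp) * rp.

(* Ts is the direction of a delta-shock with left state rm Tm and right state
   rp Tp. *)
Definition delta_shock_direction (R : realType) (n : nat) (phi : R -> R)
    (K : 'rV[R]_n -> R) (rm rp : R) (Tm Tp Ts : 'rV[R]_n) : Prop :=
  let w := alpha_plus phi K rm rp Tm Tp *: Tp
           + alpha_minus phi K rm rp Tm Tp *: Tm in
  [/\ sphere Ts, l2norm w *: Ts = w & K Ts = 0].

(* Main.v *)
Require Import Defs.
From HB Require Import structures.
From mathcomp Require Import all_boot all_order all_algebra.
From mathcomp Require Import all_classical all_reals all_analysis.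
From mathcomp Require Import ring.
Import Order.TTheory GRing.Theory Num.Theory.
Import numFieldNormedType.Exports.
Local Open Scope classical_set_scope.
Local Open Scope ring_scope.

(** Substituting the shock speed [s] into the two fluxes gives

      s - phi(z+) = D z-   and   s - phi(z-) = D z+,

    where D = (phi(z-) - phi(z+)) / (z- - z+) is the slope of the chord of
    [phi] between [z+] and [z-].  Since z- = r- K- and z+ = r+ K+, the weights
    are alpha+ = r- r+ D K- and alpha- = - r- r+ D K+, so that

      alpha+ T+ + alpha- T- = (r- r+ D) (K- T+ - K+ T-)

    ([delta_shock_weight]).  The common factor is positive because [phi] is
    strictly increasing and z+ < 0 < z-, and the normalisation x / |x| does not
    see positive factors ([direction_scale]).

    It remains to see that the normalisation is legitimate: were
    K- T+ - K+ T- zero, the unit vectors T+ and T- would be proportional, hence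
    equal or opposite ([sphere_collinear]). *)

Lemma l2norm_scale (R : realType) (n : nat) (a : R) (x : 'rV[R]_n) :
  l2norm (a *: x) = `|a| * l2norm x.
Proof.
rewrite /l2norm -sqrtr_sqr -sqrtrM ?sqr_ge0 // mulr_sumr.
by congr Num.sqrt; apply: eq_bigr => i _; rewrite mxE exprMn.
Qed.

Lemma l2norm_eq0 (R : realType) (n : nat) (x : 'rV[R]_n) :
  l2norm x = 0 -> x = 0.
Proof.
move=> /eqP; rewrite sqrtr_eq0 => sum_le0.
have sum_eq0 : \sum_(i < n) x 0 i ^+ 2 = 0.
  by apply/eqP; rewrite eq_le sum_le0 sumr_ge0 // => i _; rewrite sqr_ge0.
apply/rowP => i; rewrite mxE; apply/eqP; rewrite -sqrf_eq0; apply/eqP.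
by apply: (psumr_eq0P _ sum_eq0) => // j _; rewrite sqr_ge0.
Qed.

Lemma direction_scale (R : realType) (n : nat) (c : R) (x : 'rV[R]_n) :
  0 < c -> direction (c *: x) = direction x.
Proof.
move=> c_gt0; rewrite /direction l2norm_scale gtr0_norm // scalerA invfM.
by rewrite mulrAC mulVf ?gt_eqF // mul1r.
Qed.

Lemma eq_direction (R : realType) (n : nat) (T w : 'rV[R]_n) :
  w <> 0 -> l2norm w *: T = w -> T = direction w.
Proof.
move=> w_neq0 Tw; have nw_neq0 : l2norm w != 0.
  by apply/eqP => /l2norm_eq0.
by rewrite /direction -[X in _ = _ *: X]Tw scalerA mulVf // scale1r.
Qed.

(** Comparing norms in [a *: T1 = b *: T2] gives |a| = |b|. *)
Lemma sphere_collinear (R : realType) (n : nat) (a b : R) (T1 T2 : 'rV[R]_n) :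
  sphere T1 -> sphere T2 -> a != 0 -> a *: T1 = b *: T2 ->
  T1 = T2 \/ T1 = - T2.
Proof.
rewrite /sphere /= => nT1 nT2 a_neq0 abT.
have := congr1 (@l2norm R n) abT.
rewrite !l2norm_scale nT1 nT2 !mulr1 => /eqP; rewrite eqr_norm2.
case/orP => /eqP ab; [left | right]; apply: (scalerI a_neq0).
  by rewrite abT -ab.
by rewrite abT ab scalerN scaleNr opprK.
Qed.

Lemma derive1_gt0_increasing (R : realType) (phi : R -> R) :
  (forall z, derivable phi z 1) -> (forall z, 0 < derive1 phi z) ->
  {homo phi : x y / x < y}.
Proof.
move=> dphi phi'_gt0 x y xy.
apply: (@gtr0_derive1_incr R phi x y) => //.
by apply: derivable_within_continuous => z _.
Qed.

(** The identities s - phi(z+) = D z- and s - phi(z-) = D z+ for the chord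
    slope D exhibit both weights as multiples of r- r+ D. *)
Lemma delta_shock_weight (R : realType) (n : nat) (phi : R -> R)
    (K : 'rV[R]_n -> R) (rm rp : R) (Tm Tp : 'rV[R]_n) :
  let zm := rm * K Tm in
  let zp := rp * K Tp in
  zm != zp ->
  alpha_plus phi K rm rp Tm Tp *: Tp + alpha_minus phi K rm rp Tm Tp *: Tm
  = (rm * rp * ((phi zm - phi zp) / (zm - zp))) *:
      (K Tm *: Tp - K Tp *: Tm).
Proof.
move=> zm zp; rewrite -subr_eq0 => z_neq0.
rewrite scalerBr !scalerA -scaleNr /alpha_plus /alpha_minus /shock_speed.
rewrite -/zm -/zp; congr (_ *: _ + _ *: _).
  have -> : rm * rp * ((phi zm - phi zp) / (zm - zp)) * K Tm
          = zm * ((phi zm - phi zp) / (zm - zp)) * rp by rewrite /zm; ring.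
  by move: zm zp z_neq0 => zm zp z_neq0; field.
have -> : - (rm * rp * ((phi zm - phi zp) / (zm - zp)) * K Tp)
        = - (zp * ((phi zm - phi zp) / (zm - zp)) * rm) by rewrite /zp; ring.
by move: zm zp z_neq0 => zm zp z_neq0; field.
Qed.

Theorem lemma5p26 (R : realType) (n : nat) (hn : (2 <= n)%N)
  (K : 'rV[R]_n -> R) (hK : admissible_K K)
  (phi : R -> R) (hphi : admissible_phi phi)
  (rm rp : R) (hrm : 0 < rm) (hrp : 0 < rp)
  (Tm Tp : 'rV[R]_n) (hTm : sphere Tm) (hTp : sphere Tp)
  (hne : Tp <> Tm) (hneN : Tp <> - Tm)
  (hKm : 0 < K Tm) (hKp : K Tp < 0)
  (Ts : 'rV[R]_n)
  (hTs : delta_shock_direction phi K rm rp Tm Tp Ts)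
  (hrel : K (direction (K Tm *: Tp - K Tp *: Tm)) = 0) :
  Ts = direction (K Tm *: Tp - K Tp *: Tm).
Proof.
have [dphi _ phi'_gt0 _] := hphi.
have phi_incr : {homo phi : x y / x < y}.
  by apply: derive1_gt0_increasing => // z; exact: (dphi 0%N z).
have zp_lt_zm : rp * K Tp < rm * K Tm.
  by rewrite (@lt_trans _ _ 0) ?pmulr_rlt0 ?mulr_gt0.
have [_ Tsw _] := hTs; rewrite delta_shock_weight ?gt_eqF // in Tsw.
set c := rm * rp * _ in Tsw.
have c_gt0 : 0 < c by rewrite !mulr_gt0 ?invr_gt0 ?subr_gt0 // phi_incr.
have v_neq0 : K Tm *: Tp - K Tp *: Tm <> 0.
  move=> /eqP; rewrite subr_eq0 => /eqP collin.
  by case: (sphere_collinear _ _ _ _ _ _ hTp hTm _ collin); rewrite ?gt_eqF.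
rewrite -(direction_scale _ _ c _ c_gt0); apply: eq_direction Tsw.
by move/eqP; rewrite scaler_eq0 gt_eqF //= => /eqP.
Qed.
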